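(* Let $\mathbf{M}_1=(S,\mathcal{I}_1)$ and $\mathbf{M}_2=(S,\mathcal{I}_2)$ be matroids on the same finite ground set $S$ with rank functions $r_1$ and $r_2$. Suppose $r_1(S)=r_2(S)=:r$, and let $k\le r$ be a positive integer. Suppose that for every $X\subseteq S$ and $i=1,2$, $r_i(X)=|X|$ holds if $|X|\le r-k$, and $r_i(X)=r$ holds if $|X|\ge r+k$. Let $w\in\mathbb{Z}^S$ be a weight vector and let $B$ be an upper bound on the absolute values of $w(s)$ for $s\in S$. Then a maximum weight common independent set of $\mathbf{M}_1$ and $\mathbf{M}_2$ (a set $I\in\mathcal{I}_1\cap\mathcal{I}_2$ maximizing $\sum_{s\in I}w(s)$) can be computed in time polynomial in $|S|^k$ and $\log B$ in the minimum rank oracle model.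
   Context: The minimum rank function of $\mathbf{M}_1$ and $\mathbf{M}_2$ is $r_{\min}:2^S\to\mathbb{Z}$, $r_{\min}(X)=\min\{r_1(X),r_2(X)\}$. In the minimum rank oracle model, the algorithm accesses the two matroids only through an oracle that, for each queried $X\subseteq S$, returns only $r_{\min}(X)$ (and not $r_1(X)$ and $r_2(X)$ individually). *)

(* Defs.v *)
From mathcomp Require Import all_boot all_order all_algebra.

Set Implicit Arguments.
Unset Strict Implicit.
Unset Printing Implicit Defensive.

Import GRing.Theory Num.Theory.

Record matroid (S : finType) := Matroid {
  indep : {set {set S}};
  indep0 : set0 \in indep;
  indepS : forall I J : {set S}, I \subset J -> J \in indep -> I \in indep;
  indep_aug : forall I J : {set S}, I \in indep -> J \in indep -> #|I| < #|J| ->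
    exists2 x, x \in J :\: I & x |: I \in indep }.

Definition rank (S : finType) (M : matroid S) (X : {set S}) : nat :=
  \max_(I : {set S} | (I \subset X) && (I \in indep M)) #|I|.

Definition rmin (S : finType) (M1 M2 : matroid S) (X : {set S}) : nat :=
  minn (rank M1 X) (rank M2 X).

Definition common_indep (S : finType) (M1 M2 : matroid S) : {set {set S}} :=
  indep M1 :&: indep M2.

Definition max_weight_common_indep (S : finType) (M1 M2 : matroid S)
    (w : S -> int) (I : {set S}) : Prop :=
  I \in common_indep M1 M2 /\
  forall J, J \in common_indep M1 M2 ->
    (\sum_(s in J) w s <= \sum_(s in I) w s)%R.

(* The model of computation is a random access machine with logarithmic (bit) *)
(* cost, programmed by structured commands and extended with a set oracle.    *)
(* It has integer registers indexed by integers; multiplication is not        *)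
(* primitive.                                                                 *)

Definition memory := int -> int.

Definition set_mem (m : memory) (a v : int) : memory :=
  fun b => if b == a then v else m b.

Inductive expr :=
  | Lit of int
  | Read of expr
  | Add of expr & expr
  | Sub of expr & expr.

Inductive cmd :=
  | Skip
  | Store of expr & expr
  | Seq of cmd & cmd
  | Ite of expr & cmd & cmd
  | While of expr & cmd
  | Query of expr & expr.

Fixpoint eval (m : memory) (e : expr) : int :=
  match e with
  | Lit z => z
  | Read a => m (eval m a)
  | Add e1 e2 => (eval m e1 + eval m e2)%R
  | Sub e1 e2 => (eval m e1 - eval m e2)%R
  end.

(* Number of binary digits of |z| (at least 1). *)
Definition bits (z : int) : nat := (trunc_log 2 `|z|).+1.

(* Each subexpression, including every address read, is charged the bit       *)
(* length of its value.                                                       *)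
Fixpoint ecost (m : memory) (e : expr) : nat :=
  bits (eval m e) +
  match e with
  | Lit _ => 0
  | Read a => ecost m a
  | Add e1 e2 | Sub e1 e2 => ecost m e1 + ecost m e2
  end.

(* The machine sees the elements of S only as the indices 0, ..., |S|-1;       *)
(* a subset of S is stored as a characteristic vector in consecutive cells.   *)
Definition set_at (S : finType) (m : memory) (a : int) : {set S} :=
  [set s : S | m (a + (enum_rank s)%:Z)%R != 0%R].

Definition set_cost (S : finType) (m : memory) (a : int) : nat :=
  \sum_(i < #|S|) (bits (a + i%:Z)%R + bits (m (a + i%:Z)%R)).

(* [exec f c m t m']: with oracle f, the command c started in m halts in m'   *)
(* after t time units. Tests succeed on positive values; [Query a b] writes   *)
(* at address a the answer of the oracle to the set stored at address b.      *)
Inductive exec (S : finType) (f : {set S} -> nat) :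
    cmd -> memory -> nat -> memory -> Prop :=
  | exec_skip m : exec f Skip m 1 m
  | exec_store m a e :
      exec f (Store a e) m (ecost m a + ecost m e).+1
        (set_mem m (eval m a) (eval m e))
  | exec_seq m m1 m2 c1 c2 t1 t2 :
      exec f c1 m t1 m1 -> exec f c2 m1 t2 m2 ->
      exec f (Seq c1 c2) m (t1 + t2) m2
  | exec_ite_true m m' e c1 c2 t :
      (0 < eval m e)%R -> exec f c1 m t m' ->
      exec f (Ite e c1 c2) m (ecost m e + t).+1 m'
  | exec_ite_false m m' e c1 c2 t :
      ~~ (0 < eval m e)%R -> exec f c2 m t m' ->
      exec f (Ite e c1 c2) m (ecost m e + t).+1 m'
  | exec_while_true m m1 m2 e c t1 t2 :
      (0 < eval m e)%R -> exec f c m t1 m1 -> exec f (While e c) m1 t2 m2 ->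
      exec f (While e c) m (ecost m e + t1 + t2).+1 m2
  | exec_while_false m e c :
      ~~ (0 < eval m e)%R -> exec f (While e c) m (ecost m e).+1 m
  | exec_query m a b :
      let v := (f (set_at S m (eval m b)))%:Z%R in
      exec f (Query a b) m
        (ecost m a + ecost m b + set_cost S m (eval m b) + bits v).+1
        (set_mem m (eval m a) v).

Lemma exec_det (S : finType) (f : {set S} -> nat) c m t1 m1 t2 m2 :
  exec f c m t1 m1 -> exec f c m t2 m2 -> t1 = t2 /\ m1 = m2.
Proof.
move=> H; elim: H t2 m2 => {c m t1 m1}; intros;
  match goal with H : exec f (_ _) _ ?t _ |- ?u = ?t /\ _ => inversion H; subst
                | H : exec f Skip _ _ _ |- _ => inversion H; subst end;
  repeat match goal with
  | p : is_true (~~ ?b), q : is_true ?b |- _ => by rewrite q in p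
  | I : forall t m, exec f ?c ?m0 t m -> _, E : exec f ?c ?m0 _ _ |- _ =>
      case: (I _ _ E) => ??; subst; clear I
  end; by [].
Qed.

(* Cell 0 holds |S|, cell 1 holds k, cells 2, ..., |S|+1 hold the weights and *)
(* all other cells are 0.                                                     *)
Definition input (S : finType) (k : nat) (w : S -> int) : memory :=
  fun a => match a with
  | Posz 0 => #|S|%:Z%R
  | Posz 1 => k%:Z%R
  | Posz i.+2 => nth 0%R [seq w s | s <- enum S] i
  | Negz _ => 0%R
  end.

Definition output (S : finType) (m : memory) : {set S} := set_at S m 0%R.

(* Main.v *)
Require Import Defs.
From mathcomp Require Import all_boot all_order all_algebra.
From mathcomp Require Import zify.
From Stdlib Require Import FunctionalExtensionality.

Set Implicit Arguments.
Unset Strict Implicit.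
Unset Printing Implicit Defensive.

Import Defs Order.TTheory GRing.Theory Num.Theory.

(* Order S by decreasing weight, ties broken by index. Let I be common          *)
(* independent and let T consist of the first |I| elements of S. For x outside  *)
(* I, each matroid has at most k elements y of I such that I - y + x is         *)
(* dependent, because all sets of size r - k are independent. Hence, as long as *)
(* |I \ T| > 2k, some y in I \ T can be replaced by a given x in T \ I in both  *)
(* matroids at no loss of weight, and so some optimal I has |I \ T| <= 2k.      *)
(* The program therefore tries every element s and every 4k-tuple of elements,  *)
(* and queries the set obtained from the prefix ending in s by flipping the     *)
(* entries of the tuple one after the other; since flipping twice has no        *)
(* effect, tuples of this fixed length reach every set at even distance at most *)
(* 4k from the prefix.                                                          *)

(** * Common independent sets near a prefix of the weight order *)

(** The exchange bound for one matroid is [card_unexchangeable]; [common_indep_near_top] applies it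
    to both matroids at once, and [optimal_candidate] turns it into a description of some optimum,
    unless that optimum is empty, by $4k+1$ element indices. The oracle suffices because
    $r_{\min}(X)=|X|$ holds exactly for common independent $X$ ([common_indep_rmin]); starting from
    the empty set, the program keeps the heaviest candidate that passes this test. With $n=|S|$, the
    $n^{4k+1}$ index tuples are run through as the base-$n$ digits of a counter. By [digits_surj]
    none is missed, and [run_search] maintains the invariant [searched]. A round takes $O(n+k)$
    steps on numbers of $O(\log(n(B+1)))$ bits. For $N=n^k\ge n$ this gives $O(N^6)$ steps in all
    ([steps_le]), hence a polynomial in $N$ and $\log B$. *)

Section Rank.
Variables (S : finType) (M : matroid S).
Implicit Types I J X : {set S}.

Lemma rank_le_card X : rank M X <= #|X|.
Proof. by apply/bigmax_leqP => I /andP[/subset_leq_card]. Qed.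

Lemma indep_rank X : (X \in indep M) = (rank M X == #|X|).
Proof.
apply/idP/eqP => [Xi | rX].
  apply/eqP; rewrite eqn_leq rank_le_card /rank.
  by apply: (leq_bigmax_cond X); rewrite subxx.
have [|I /andP[sIX Ii] cI] := @eq_bigmax_cond _
    (fun I : {set S} => (I \subset X) && (I \in indep M)) (fun I => #|I|).
  by apply/card_gt0P; exists set0; rewrite unfold_in /= sub0set indep0.
move: rX; rewrite /rank cI => eqI.
by have /eqP <- : I == X by rewrite eqEcard sIX eqI leqnn.
Qed.

Lemma card_indep_le_rank I : I \in indep M -> #|I| <= rank M [set: S].
Proof. by move=> Ii; apply: (leq_bigmax_cond I); rewrite subsetT. Qed.

(** Augment [A] from [I] until the sizes agree; every added element lies in [I]. *)
Lemma indep_extend I A : I \in indep M -> A \in indep M -> #|A| <= #|I| ->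
  exists J, [/\ A \subset J, J \subset A :|: I, J \in indep M & #|J| = #|I|].
Proof.
move=> Ii; have [n] := ubnP (#|I| - #|A|); elim: n A => // n IHn A ltn Ai.
rewrite leq_eqVlt => /orP[/eqP cA | ltAI].
  by exists A; rewrite subsetUl.
have [x /setDP[xI xA] xAi] := indep_aug Ai Ii ltAI.
have cxA : #|x |: A| = #|A|.+1 by rewrite cardsU1 xA.
have [||| J [sAJ sJ Ji cJ]] := IHn (x |: A) => //; try by lia.
exists J; split=> //; first exact: subset_trans (subsetUr _ _) sAJ.
apply: subset_trans sJ _; rewrite -setUA subUset subxx andbT sub1set.
by rewrite inE xI orbT.
Qed.

(** With more than $k$ bad elements, removing them all from [I] and adding [x] leaves at most $r-k$
    elements, an independent set. Extending it from [I] to size $|I|$ gives $I-y+x$ for some bad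
    [y], a contradiction. *)
Lemma card_unexchangeable (r k : nat) I x :
  rank M [set: S] = r -> k <= r ->
  (forall X : {set S}, #|X| <= r - k -> rank M X = #|X|) ->
  I \in indep M -> x \notin I ->
  #|[set y in I | x |: (I :\ y) \notin indep M]| <= k.
Proof.
move=> rM lekr smallM Ii xI; set bad := [set y in I | _].
have small X : #|X| <= r - k -> X \in indep M.
  by move=> /smallM/eqP; rewrite -indep_rank.
have leIr : #|I| <= r by rewrite -rM card_indep_le_rank.
have sbI : bad \subset I by apply/subsetP => y /setIdP[].
rewrite leqNgt; apply/negP => ltkb.
have := subset_leq_card sbI; have := cardsID bad I.
rewrite (setIidPr sbI) => cI lebI.
have cAlt : #|x |: (I :\: bad)| <= r - k.
  by rewrite cardsU1 !inE (negPf xI) andbF /=; lia.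
have [|J [sAJ sJ Ji cJ]] := indep_extend Ii (small _ cAlt).
  by move: ltkb cI; rewrite cardsU1 !inE (negPf xI) andbF /=; lia.
have {}sJ : J \subset x |: I.
  by apply: subset_trans sJ _; rewrite subUset subsetUr setUS ?subsetDl.
(* [J] lies in [x |: I] and has one element less, so it misses exactly one [y]. *)
have [y yI yJ] : exists2 y, y \in x |: I & y \notin J.
  by apply/subsetPn/negP => /subset_leq_card; rewrite cardsU1 xI cJ add1n ltnn.
have xJ : x \in J by apply: (subsetP sAJ); rewrite setU11.
have nyx : y != x by apply: contraNneq yJ => ->.
have {}yI : y \in I by move: yI; rewrite !inE (negPf nyx).
have yb : y \in bad.
  by apply: contraR yJ => yb; apply: (subsetP sAJ); rewrite in_setU1 in_setD yb yI orbT.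
have /negP[] : x |: (I :\ y) \notin indep M by case/setIdP: yb.
suff -> : x |: (I :\ y) = J by [].
apply/esym/eqP; rewrite eqEcard; apply/andP; split; last first.
  by rewrite cardsU1 !inE (negPf xI) andbF cJ [#|I|](cardsD1 y) yI.
apply/subsetP => z zJ; have := subsetP sJ z zJ; rewrite !inE.
case: eqVneq => //= _ ->; rewrite andbT.
by apply: contraNneq yJ => <-.
Qed.

End Rank.

(** Both ranks are at most $|X|$, so their minimum reaches $|X|$ only if both do. Hence one query
    decides membership in both matroids. *)
Lemma common_indep_rmin (S : finType) (M1 M2 : matroid S) X :
  (X \in common_indep M1 M2) = (#|X| <= rmin M1 M2 X).
Proof. by rewrite inE !indep_rank !eqn_leq !rank_le_card leq_min. Qed.

Lemma rmin_le_card (S : finType) (M1 M2 : matroid S) X :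
  rmin M1 M2 X <= #|X|.
Proof. by rewrite /rmin geq_min rank_le_card. Qed.

Section NearTop.
Variables (S : finType) (M1 M2 : matroid S) (r k : nat) (w : S -> int).
Hypotheses (rM1 : rank M1 [set: S] = r) (rM2 : rank M2 [set: S] = r).
Hypothesis lekr : k <= r.
Hypothesis small : forall X : {set S},
  #|X| <= r - k -> rank M1 X = #|X| /\ rank M2 X = #|X|.

Local Notation wt X := (\sum_(s in X) w s)%R.

Lemma common_indep_near_top (T I : {set S}) :
  (forall x y, x \in T -> y \notin T -> (w y <= w x)%R) ->
  #|T| = #|I| -> I \in common_indep M1 M2 ->
  exists J, [/\ J \in common_indep M1 M2, (wt I <= wt J)%R, #|J| = #|T|
              & #|J :\: T| <= 2 * k].
Proof.
move=> topT; have [n] := ubnP #|I :\: T|; elim: n I => // n IHn I ltIn cTI Ic.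
have [leIk | ltkI] := leqP #|I :\: T| (2 * k); first by exists I.
have /andP[Ii1 Ii2] : (I \in indep M1) && (I \in indep M2) by rewrite -in_setI.
have [x xT xI] : exists2 x, x \in T & x \notin I.
  apply/subsetPn/negP => sTI; have /eqP eTI : T == I.
    by rewrite eqEcard sTI cTI leqnn.
  by move: ltkI; rewrite eTI setDv cards0.
pose bad M := [set y in I | x |: (I :\ y) \notin indep M].
have b1 : #|bad M1| <= k.
  by apply: card_unexchangeable rM1 _ _ Ii1 xI => // X /small[].
have b2 : #|bad M2| <= k.
  by apply: card_unexchangeable rM2 _ _ Ii2 xI => // X /small[].
(* The two bad sets have at most $2k$ elements together, fewer than [I :\: T]. *)
have [y /setDP[yI yT] ynb] :
    exists2 y, y \in I :\: T & y \notin bad M1 :|: bad M2.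
  apply/subsetPn; apply: contraL ltkI => /subset_leq_card le.
  rewrite -leqNgt (leq_trans le) // (leq_trans (leq_card_setU _ _)) //.
  by rewrite mul2n -addnn leq_add.
have Jc : x |: (I :\ y) \in common_indep M1 M2.
  by move: ynb; rewrite !inE yI /= negb_or !negbK.
have xIy : x \notin I :\ y by rewrite !inE (negPf xI) andbF.
have cJ : #|x |: (I :\ y)| = #|I|.
  by rewrite cardsU1 xIy [#|I|](cardsD1 y) yI.
have [||| J [Jci wJ cJT dJ]] := IHn (x |: (I :\ y)) => //.
- suff /proper_card/leq_trans : (x |: (I :\ y)) :\: T \proper I :\: T.
    by apply; rewrite -ltnS.
  apply/properP; split; last first.
    exists y; rewrite !inE ?yI ?yT // eqxx /= orbF.
    by apply: contraNneq xI => <-.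
  apply/subsetP => z; rewrite !inE => /andP[zT]; rewrite zT.
  by case: eqVneq zT => [-> | _ _ /andP[]//]; rewrite xT.
- by rewrite cJ.
exists J; split=> //; apply: le_trans wJ.
rewrite big_setU1 //= [X in (X <= _)%R](big_setD1 y) //=.
by rewrite lerD2r topT.
Qed.

End NearTop.

(** * The weight order, its prefixes, and flips *)

Definition precedes (u : nat -> int) (i s : nat) : bool :=
  (u s < u i)%R || ((u i == u s) && (i < s)).

Lemma precedesxx u i : precedes u i i = false.
Proof. by rewrite /precedes ltxx eqxx ltnn. Qed.

Lemma precedes_trans u j i l : precedes u i j -> precedes u j l -> precedes u i l.
Proof. rewrite /precedes; lia. Qed.

Lemma precedes_total u i j : i != j -> precedes u i j || precedes u j i.
Proof. rewrite /precedes; lia. Qed.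

Fixpoint flips (x : nat -> bool) (d : nat -> nat) (j i : nat) : bool :=
  if j is j'.+1 then flips x d j' i (+) (i == d j') else x i.

(** Only the parity of the number of occurrences of [i] among the digits matters, so the order is
    irrelevant and repeated digits can serve as padding. *)
Lemma flipsE x d j i : flips x d j i = x i (+) odd (count_mem i (mkseq d j)).
Proof.
elim: j => [|j IHj]; first by rewrite addbF.
by rewrite mkseqS [LHS]/= IHj -cats1 count_cat oddD /= addn0 oddb addbA eq_sym.
Qed.

Section Candidates.
Variables (S : finType) (w : S -> int).

Definition weights (i : nat) : int := nth 0%R [seq w s | s <- enum S] i.

Definition subset_at (x : nat -> bool) : {set S} := [set s | x (enum_rank s)].

Lemma weights_rank s : weights (enum_rank s) = w s.
Proof.
rewrite /weights (nth_map s) ?nth_enum_rank // -cardE; exact: ltn_ord.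
Qed.

Lemma sum_subset_at (V : nmodType) (F : nat -> V) x :
  (\sum_(s in subset_at x) F (enum_rank s) = \sum_(i < #|S| | x i) F i)%R.
Proof.
rewrite [RHS](reindex enum_rank) /=; last first.
  by apply: onW_bij; exists enum_val; [apply: enum_rankK | apply: enum_valK].
by apply: eq_bigl => s; rewrite inE.
Qed.

Definition prefix (s : S) : {set S} := subset_at (precedes weights ^~ (enum_rank s)).

(** Ties are broken, so the order is total and prefix sizes grow strictly along it. Thus
    $s\mapsto|\mathrm{prefix}(s)|$ is an injection from $S$ to $\{0,\dots,|S|-1\}$, hence a
    bijection. *)
Lemma prefix_card l : l < #|S| -> exists s, #|prefix s| = l.
Proof.
move=> ltl.
have ltp s : #|prefix s| < #|S|.
  rewrite -cardsT; apply/proper_card/properP; split; first exact: subsetT.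
  by exists s; rewrite ?inE ?precedesxx.
have prec_card s t : precedes weights (enum_rank s) (enum_rank t) ->
    #|prefix s| < #|prefix t|.
  move=> st; apply/proper_card/properP; split.
    by apply/subsetP => v; rewrite !inE => /precedes_trans; apply.
  by exists s; rewrite !inE // precedesxx.
pose f (i : 'I_#|S|) := Ordinal (ltp (enum_val i)).
have finj : injective f.
  move=> i j /(congr1 val) /= eqf; apply/val_inj/eqP/negPn/negP => /=.
  rewrite -(enum_valK i) -(enum_valK j) => /(precedes_total weights)/orP[]/prec_card;
    by rewrite eqf ltnn.
have [g fK gK] := injF_bij finj.
exists (enum_val (g (Ordinal ltl))).
exact: (congr1 val (gK (Ordinal ltl))).
Qed.

(** The digits are [s], then the elements of [E], then [s] repeated an even number of times as
    padding. The first digit is used twice: it selects the strict prefix, and its flip adds [s]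
    itself. *)
Lemma flips_set (s : S) (E : {set S}) m :
  #|E| <= m.*2 -> ~~ odd #|E| ->
  exists d, [/\ forall j, d j < #|S|, d 0 = enum_rank s :> nat &
    subset_at (flips (precedes weights ^~ (d 0)) d m.*2.+1) =
      [set t | (t \in s |: prefix s) (+) (t \in E)]].
Proof.
move=> leE evE.
pose c : seq nat := (enum_rank s : nat) ::
  ([seq (enum_rank t : nat) | t <- enum E] ++ nseq (m.*2 - #|E|) ((enum_rank s : nat))).
have sc : size c = m.*2.+1.
  by rewrite /= size_cat size_map -cardE size_nseq subnKC.
(* The default value keeps [d j] below $|S|$ also beyond the end of [c]. *)
exists (nth (enum_rank s : nat) c); split=> // [j|].
  have [ltj|gej] := ltnP j (size c); last by rewrite nth_default ?ltn_ord.
  have /= := mem_nth (enum_rank s : nat) ltj.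
  rewrite inE mem_cat => /or3P[/eqP-> | /mapP[t _ ->] | ]; rewrite ?ltn_ord //.
  by rewrite mem_nseq => /andP[_ /eqP->]; apply: ltn_ord.
apply/setP => t; rewrite !inE flipsE -sc mkseq_nth /= oddD count_cat oddD.
rewrite count_nseq oddM oddB // odd_double (negPf evE) andbF addbF oddb.
have rank_inj : injective (fun t : S => (enum_rank t : nat)).
  by move=> ? ? /val_inj/enum_rank_inj.
rewrite count_uniq_mem; last by rewrite map_inj_uniq ?enum_uniq.
rewrite oddb addbA; congr (_ (+) _); last first.
  by rewrite (mem_map rank_inj) mem_enum.
rewrite (inj_eq rank_inj) eq_sym.
by case: eqVneq => [->|_]; rewrite ?precedesxx ?addbF.
Qed.

Lemma optimal_candidate (M1 M2 : matroid S) (r k : nat) :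
  rank M1 [set: S] = r -> rank M2 [set: S] = r -> k <= r ->
  (forall X : {set S}, #|X| <= r - k -> rank M1 X = #|X| /\ rank M2 X = #|X|) ->
  exists2 I, max_weight_common_indep M1 M2 w I &
    I = set0 \/ exists2 d, (forall j, d j < #|S|) &
      I = subset_at (flips (precedes weights ^~ (d 0)) d (4 * k).+1).
Proof.
move=> rM1 rM2 lekr small.
have c0 : set0 \in common_indep M1 M2 by rewrite inE !indep0.
pose wt (I : {set S}) := (\sum_(s in I) w s)%R.
have [I Ic maxI] := @arg_maxP _ _ _ set0 (mem (common_indep M1 M2)) wt c0.
(* The empty optimum is separate because [s |: prefix s] is never empty. *)
have [I0|/card_gt0P[x xI]] := posnP #|I|.
  by exists I; [split | left; apply/eqP; rewrite -cards_eq0 I0].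
have cI : #|I|.-1 < #|S| by rewrite prednK ?max_card // (cardD1 x) xI.
have [s cs] := prefix_card cI.
have spre : s \notin prefix s by rewrite inE precedesxx.
have cT : #|s |: prefix s| = #|I|.
  by rewrite cardsU1 spre cs add1n prednK // (cardD1 x) xI.
have [|J [Jc wJ cJ dJ]] := common_indep_near_top rM1 rM2 lekr small _ cT Ic (w := w).
  move=> a b; rewrite !in_setU1 !in_set /precedes !weights_rank negb_or.
  have -> : (b == s) = (enum_rank b == enum_rank s :> nat).
    by rewrite (inj_eq val_inj) (inj_eq enum_rank_inj).
  by case: eqVneq => [-> | _]; lia.
exists J; first by split=> // K Kc; apply: le_trans wJ; apply: maxI.
right; set T := s |: prefix s in cT cJ dJ.
pose E := (J :\: T) :|: (T :\: J).
have dTJ : #|T :\: J| = #|J :\: T|.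
  (* Since $|J|=|T|$, the two halves of the symmetric difference [E] have equal size, so $|E|$ is
     even and at most $4k$. *)
  by have := cardsID J T; have := cardsID T J; rewrite setIC; lia.
have cE : #|E| = #|J :\: T|.*2.
  rewrite cardsU dTJ -addnn (_ : _ :&: _ = set0) ?cards0 ?subn0 //.
  by apply/setP => z; rewrite !inE; case: (z \in J); rewrite ?andbF.
have [||d [dlt d0 dE]] := @flips_set s E (2 * k).
- by rewrite cE leq_double.
- by rewrite cE odd_double.
exists d => //; have -> : (4 * k) = (2 * k).*2 by lia.
rewrite dE; apply/setP => t; rewrite in_set -/T [t \in E]in_setU !in_setD.
by case: (t \in T); case: (t \in J).
Qed.

End Candidates.

(** * Cost of commands in a bounded memory *)

Fixpoint esize (e : expr) : nat :=
  match e with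
  | Lit _ => 1
  | Read a => (esize a).+1
  | Add e1 e2 | Sub e1 e2 => (esize e1 + esize e2).+1
  end.

Fixpoint lits_le (b : nat) (e : expr) : bool :=
  match e with
  | Lit z => `|z| <= b
  | Read a => lits_le b a
  | Add e1 e2 | Sub e1 e2 => lits_le b e1 && lits_le b e2
  end.

(** Uniform limits met by the expressions of [program]; the 16 reappears in [wordbits]. *)
Definition small (e : expr) : bool := (esize e <= 16) && lits_le 20 e.

Definition mbound (W : nat) (m : memory) : Prop := forall a, `|m a| <= W.

Section Cost.
Variables (W : nat) (m : memory).
Hypotheses (leW : 20 <= W) (mW : mbound W m).

(** Without multiplication, each leaf or read contributes at most [W], so values grow only linearly
    in the size of the expression. *)
Lemma eval_bound e : lits_le 20 e -> `|eval m e| <= esize e * W.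
Proof.
elim: e => [z|a _|e1 IH1 e2 IH2|e1 IH1 e2 IH2] /=.
- by rewrite mul1n => /leq_trans; apply.
- by rewrite mulSn => _; apply: leq_trans (mW _) (leq_addr _ _).
- case/andP=> /IH1 h1 /IH2 h2; rewrite mulSn mulnDl; lia.
- case/andP=> /IH1 h1 /IH2 h2; rewrite mulSn mulnDl; lia.
Qed.

Definition wordbits : nat := (trunc_log 2 (16 * W)).+1.

Lemma bits_le z : `|z| <= 16 * W -> bits z <= wordbits.
Proof. by move=> lez; rewrite ltnS leq_trunc_log. Qed.

Lemma ecost_small e : small e -> ecost m e <= 16 * wordbits.
Proof.
have bits_eval e' : esize e' <= 16 -> lits_le 20 e' -> bits (eval m e') <= wordbits.
  move=> sz /eval_bound le; apply: bits_le; apply: leq_trans le _.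
  by rewrite leq_mul2r sz orbT.
suff cost e' : esize e' <= 16 -> lits_le 20 e' -> ecost m e' <= esize e' * wordbits.
  case/andP=> sz li; apply: leq_trans (cost _ sz li) _.
  by rewrite leq_mul2r sz orbT.
move=> sz li; have := bits_eval _ sz li.
elim: e' sz li => [z|a IH|e1 IH1 e2 IH2|e1 IH1 e2 IH2] /= sz li be.
- by rewrite addn0 mul1n.
- by rewrite mulSn leq_add // IH ?(ltnW sz) // bits_eval ?(ltnW sz).
- have /andP[l1 l2] := li; have s1 : esize e1 <= 16 by lia.
  have s2 : esize e2 <= 16 by lia.
  by rewrite mulSn mulnDl !leq_add // ?IH1 ?IH2 // bits_eval.
- have /andP[l1 l2] := li; have s1 : esize e1 <= 16 by lia.
  have s2 : esize e2 <= 16 by lia.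
  by rewrite mulSn mulnDl !leq_add // ?IH1 ?IH2 // bits_eval.
Qed.

End Cost.

Lemma mbound_set W m a v : mbound W m -> `|v| <= W -> mbound W (set_mem m a v).
Proof. by move=> mW vW b; rewrite /set_mem; case: ifP. Qed.

(** One index cell serves all loops, since they are never nested. *)
Definition For (bnd : expr) (body : cmd) : cmd :=
  Seq (Store (Lit (Negz 3)) (Lit 0))
      (While (Sub bnd (Read (Lit (Negz 3))))
         (Seq body (Store (Lit (Negz 3)) (Add (Read (Lit (Negz 3))) (Lit 1))))).

Section Runs.
Variables (S : finType) (f : {set S} -> nat) (W : nat).
Hypothesis leW : 20 <= W.

(* In a memory bounded by [W], 40 * wordbits W pays for one [Store] or one test   *)
(* of small expressions.                                                         *)
Definition runs (c : cmd) (m : memory) (s : nat) (m' : memory) : Prop :=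
  exists2 t, exec f c m t m' & t <= s * (40 * wordbits W).

Lemma runs_le c m s s' m' : s <= s' -> runs c m s m' -> runs c m s' m'.
Proof.
by move=> les [t ex le]; exists t => //; rewrite (leq_trans le) // leq_mul2r les orbT.
Qed.

Lemma runs_skip m : runs Skip m 1 m.
Proof. by exists 1; [constructor | rewrite mul1n muln_gt0]. Qed.

Lemma runs_store m m' a e : mbound W m -> small a -> small e ->
  set_mem m (eval m a) (eval m e) = m' -> runs (Store a e) m 1 m'.
Proof.
move=> mW sa se <-; exists (ecost m a + ecost m e).+1; first by constructor.
have := ecost_small leW mW sa; have := ecost_small leW mW se.
rewrite mul1n /wordbits; lia.
Qed.

Lemma runs_seq c1 c2 m m1 m2 s1 s2 :
  runs c1 m s1 m1 -> runs c2 m1 s2 m2 -> runs (Seq c1 c2) m (s1 + s2) m2.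
Proof.
move=> [t1 e1 l1] [t2 e2 l2]; exists (t1 + t2); first exact: exec_seq e1 e2.
by rewrite mulnDl leq_add.
Qed.

Lemma runs_ite m m' e c1 c2 s : mbound W m -> small e ->
  ((0 < eval m e)%R -> runs c1 m s m') ->
  (~~ (0 < eval m e)%R -> runs c2 m s m') -> runs (Ite e c1 c2) m s.+1 m'.
Proof.
move=> mW se h1 h2; have ce := ecost_small leW mW se.
have [pos | npos] := boolP (0 < eval m e)%R; [have [t ex lt] := h1 pos |
  have [t ex lt] := h2 npos]; exists (ecost m e + t).+1; try by constructor.
all: by rewrite mulSn; move: ce lt; rewrite /wordbits; lia.
Qed.

Lemma runs_while_true m m1 m2 e c s1 s2 : mbound W m -> small e ->
  (0 < eval m e)%R -> runs c m s1 m1 -> runs (While e c) m1 s2 m2 ->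
  runs (While e c) m (s1 + s2).+1 m2.
Proof.
move=> mW se pos [t1 e1 l1] [t2 e2 l2].
exists (ecost m e + t1 + t2).+1; first exact: exec_while_true e1 e2.
have := ecost_small leW mW se.
by rewrite -[(s1 + s2).+1]add1n !mulnDl mul1n; move: l1 l2; rewrite /wordbits; lia.
Qed.

Lemma runs_while_false m e c : mbound W m -> small e ->
  ~~ (0 < eval m e)%R -> runs (While e c) m 1 m.
Proof.
move=> mW se npos; exists (ecost m e).+1; first exact: exec_while_false.
by have := ecost_small leW mW se; rewrite mul1n /wordbits; lia.
Qed.

(** Scanning the set costs two words per element, covered by one step each; the final step pays for
    the two expressions and the answer. *)
Lemma runs_query m m' a b : mbound W m -> #|S| <= W -> small a -> small b ->
  `|eval m b| <= W -> f (set_at S m (eval m b)) <= W ->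
  set_mem m (eval m a) (f (set_at S m (eval m b)))%:Z%R = m' ->
  runs (Query a b) m (#|S| + 1) m'.
Proof.
move=> mW leS sa sb bW fW <-.
eexists; first exact: exec_query.
have := ecost_small leW mW sa; have := ecost_small leW mW sb.
have /(@bits_le W) : `|(f (set_at S m (eval m b)))%:Z%R| <= 16 * W by lia.
have : set_cost S m (eval m b) <= #|S| * (2 * wordbits W).
  rewrite -[X in X * _]card_ord -sum_nat_const leq_sum // => i _.
  rewrite mul2n -addnn leq_add // bits_le //; last exact: leq_trans (mW _) (leq_pmull _ _).
  by have := ltn_ord i; lia.
rewrite mulnDl mul1n.
have : #|S| * (2 * wordbits W) <= #|S| * (40 * wordbits W).
  by rewrite leq_mul2l leq_mul2r ?orbT.
rewrite /wordbits; lia.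
Qed.

(** In [G p i], [p] counts finished iterations and [i] is the index cell; they differ between the
    end of a body and the increment, and at the start, where [i0] is left over from earlier code.
    Each iteration adds a test and an increment; the last 2 pays for the initial store and the
    failing test. *)
Lemma runs_for N s (G : nat -> nat -> memory) bnd body i0 :
  N <= W -> i0 <= W -> esize bnd <= 10 -> lits_le 20 bnd ->
  (forall p i, p <= N -> i <= W -> mbound W (G p i)) ->
  (forall p i, eval (G p i) bnd = N%:Z%R) ->
  (forall p i, G p i (Negz 3) = i%:Z%R) ->
  (forall p i j, set_mem (G p i) (Negz 3) j%:Z%R = G p j) ->
  (forall j, j < N -> runs body (G j j) s (G j.+1 j)) ->
  runs (For bnd body) (G 0 i0) (N * (s + 2) + 2) (G N N).
Proof.
move=> leN lei0 szb lib GW Gb Gi Gset step.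
rewrite addnS -add1n; apply: (@runs_seq _ _ _ (G 0 0)).
  by apply: runs_store => //; [apply: GW | apply: Gset].
suff loop j : j <= N -> runs (While (Sub bnd (Read (Lit (Negz 3))))
    (Seq body (Store (Lit (Negz 3)) (Add (Read (Lit (Negz 3))) (Lit 1)))))
    (G j j) ((N - j) * (s + 2) + 1) (G N N).
  by have := loop 0 isT; rewrite subn0.
have sm : small (Sub bnd (Read (Lit (Negz 3)))).
  by rewrite /small /= lib andbT; lia.
have [r] := ubnP (N - j); elim: r j => // r IHr j ltr lej.
have mG : mbound W (G j j) by apply: GW => //; apply: leq_trans lej leN.
move: lej; rewrite leq_eqVlt => /predU1P[-> | ltj].
  rewrite subnn mul0n add0n; apply: runs_while_false => //; first by apply: GW.
  by rewrite /= Gb Gi subrr.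
have -> : (N - j) * (s + 2) + 1 = ((s + 1) + ((N - j.+1) * (s + 2) + 1)).+1.
  by rewrite -(subnSK ltj) mulSn; lia.
apply: (@runs_while_true _ (G j.+1 j.+1)) => //.
- by rewrite /= Gb Gi; lia.
- apply: runs_seq (step _ ltj) _; apply: runs_store => //.
    by apply: GW => //; apply: leq_trans (ltnW ltj) leN.
  by rewrite /= Gi -PoszD addn1 Gset.
- by apply: IHr => //; lia.
Qed.

End Runs.

(** * The program and its memory *)

(* [Negz p] is the address -(p + 1). The cells [Negz 0], ..., [Negz 9] hold |S|,  *)
(* the number of digits, the best weight so far, the loop index, the size and    *)
(* the weight of the current set, the carry, the answer of the oracle, and the   *)
(* addresses of the current and of the best set; the digits start at [Negz 10].  *)
(* The two sets are stored above the weights.                                    *)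
Definition cell (p : nat) : expr := Lit (Negz p).
Definition rd (p : nat) : expr := Read (cell p).
Definition weight_at (e : expr) : expr := Read (Add (Lit 2) e).
Definition x_addr (e : expr) : expr := Add (rd 8) e.
Definition y_addr (e : expr) : expr := Add (rd 9) e.
Definition digit_addr : expr := Sub (cell 10) (rd 3).

Definition setup : cmd :=
  Seq (Store (cell 0) (Read (Lit 0)))
 (Seq (Store (cell 1) (Add (Add (Add (Add (Read (Lit 1)) (Read (Lit 1)))
                              (Read (Lit 1))) (Read (Lit 1))) (Lit 1)))
 (Seq (Store (cell 8) (Add (rd 0) (Lit 2)))
      (Store (cell 9) (Add (rd 8) (rd 0))))).

(** Tests detect only positive values, so the comparison with digit 0 (cell [Negz 10]) takes both
    differences of the weights, then the indices to break ties. *)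
Definition init_step : cmd :=
  Ite (Sub (weight_at (rd 3)) (weight_at (rd 10)))
    (Store (x_addr (rd 3)) (Lit 1))
    (Ite (Sub (weight_at (rd 10)) (weight_at (rd 3)))
      (Store (x_addr (rd 3)) (Lit 0))
      (Ite (Sub (rd 10) (rd 3))
        (Store (x_addr (rd 3)) (Lit 1))
        (Store (x_addr (rd 3)) (Lit 0)))).

Definition flip_step : cmd :=
  Store (x_addr (Read digit_addr))
    (Sub (Lit 1) (Read (x_addr (Read digit_addr)))).

Definition count_step : cmd :=
  Ite (Read (x_addr (rd 3)))
    (Seq (Store (cell 4) (Add (rd 4) (Lit 1)))
         (Store (cell 5) (Add (rd 5) (weight_at (rd 3)))))
    Skip.

Definition save_step : cmd :=
  Store (y_addr (rd 3)) (Read (x_addr (rd 3))).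

(** One position of a base-$n$ increment, least significant digit first. *)
Definition carry_step : cmd :=
  Ite (rd 6)
    (Ite (Sub (Sub (rd 0) (Lit 1)) (Read digit_addr))
      (Seq (Store digit_addr (Add (Read digit_addr) (Lit 1)))
           (Store (cell 6) (Lit 0)))
      (Store digit_addr (Lit 0)))
    Skip.

(** This overwrites the input cells, hence the copy of $|S|$ made by [setup]. The source lies above
    all cells written, so it stays intact. *)
Definition output_step : cmd := Store (rd 3) (Read (y_addr (rd 3))).

(** After the query, positivity of answer $+1-$ size means that the size is at most the answer, i.e.
    that the set is accepted. *)
Definition round : cmd :=
  Seq (For (rd 0) init_step)
 (Seq (For (rd 1) flip_step)
 (Seq (Seq (Store (cell 4) (Lit 0)) (Store (cell 5) (Lit 0)))
 (Seq (For (rd 0) count_step)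
 (Seq (Query (cell 7) (rd 8))
 (Seq (Ite (Sub (Add (rd 7) (Lit 1)) (rd 4))
        (Ite (Sub (rd 5) (rd 2))
          (Seq (Store (cell 2) (rd 5)) (For (rd 0) save_step))
          Skip)
        Skip)
 (Seq (Store (cell 6) (Lit 1))
      (For (rd 1) carry_step))))))).

(* The search ends with the carry out of the last digit. *)
Definition program : cmd :=
  Seq setup (Seq (While (Sub (Lit 1) (rd 6)) round) (For (rd 0) output_step)).

(** * Memory layout *)

Section Layout.
Variables (n k D : nat) (u : nat -> int).

(** The entire memory is a function of these parameters, so the effect of a store is an equality of
    memories. The vectors [x] and [y] matter only below [n], whereas [d] is stored in full. *)
Definition layout (b : int) (i c : nat) (z : int) (e : bool) (q : nat)
    (d : nat -> nat) (x y : nat -> bool) : memory :=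
  fun a => match a with
  | Posz p =>
      if p < 2 then (if p == 0 then Posz n else Posz k)
      else if p < n + 2 then u (p - 2)
      else if p < n + 2 + n then Posz (x (p - (n + 2)))
      else if p < n + 2 + n + n then Posz (y (p - (n + 2 + n)))
      else Posz 0
  | Negz p => match p with
    | 0 => Posz n | 1 => Posz D | 2 => b | 3 => Posz i | 4 => Posz c | 5 => z
    | 6 => Posz e | 7 => Posz q | 8 => Posz (n + 2) | 9 => Posz (n + 2 + n)
    | _ => Posz (d (p - 10))
    end
  end.

Variables (b : int) (i c : nat) (z : int) (e : bool) (q : nat).
Variables (d : nat -> nat) (x y : nat -> bool).
Local Notation m := (layout b i c z e q d x y).

Lemma mem_weight j : j < n -> m (2%Z + j%:Z)%R = u j.
Proof.
move=> ltj; rewrite -PoszD /layout addKn.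
by case: ifP => // ?; exfalso; lia.
Qed.

Lemma mem_x j : j < n -> m ((n + 2)%:Z + j%:Z)%R = (x j : nat)%:Z%R.
Proof.
move=> ltj; rewrite -PoszD /layout addKn ltn_add2l ltj.
by do 2?[case: ifP => [? | _]; first by exfalso; lia].
Qed.

Lemma mem_y j : j < n -> m ((n + 2 + n)%:Z + j%:Z)%R = (y j : nat)%:Z%R.
Proof.
move=> ltj; rewrite -PoszD /layout addKn ltn_add2l ltj.
by do 3?[case: ifP => [? | _]; first by exfalso; lia].
Qed.

Lemma digit_cell j : (Negz 10 - j%:Z)%R = Negz (10 + j).
Proof. lia. Qed.

Lemma mem_digit j : m (Negz 10 - j%:Z)%R = (d j)%:Z%R.
Proof. by rewrite digit_cell /= addnC addnK. Qed.

Lemma set_best v : set_mem m (Negz 2) v = layout v i c z e q d x y.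
Proof. by apply: functional_extensionality => -[p|[|[|[|p]]]]. Qed.

Lemma set_idx j : set_mem m (Negz 3) j%:Z%R = layout b j c z e q d x y.
Proof. by apply: functional_extensionality => -[p|[|[|[|[|p]]]]]. Qed.

Lemma set_count j : set_mem m (Negz 4) j%:Z%R = layout b i j z e q d x y.
Proof. by apply: functional_extensionality => -[p|[|[|[|[|[|p]]]]]]. Qed.

Lemma set_sum v : set_mem m (Negz 5) v = layout b i c v e q d x y.
Proof. by apply: functional_extensionality => -[p|[|[|[|[|[|[|p]]]]]]]. Qed.

Lemma set_carry e' : set_mem m (Negz 6) (nat_of_bool e')%:Z%R = layout b i c z e' q d x y.
Proof. by apply: functional_extensionality => -[p|[|[|[|[|[|[|[|p]]]]]]]]. Qed.

Lemma set_answer j : set_mem m (Negz 7) j%:Z%R = layout b i c z e j d x y.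
Proof. by apply: functional_extensionality => -[p|[|[|[|[|[|[|[|[|p]]]]]]]]]. Qed.

Lemma set_digit j v d' : (forall l, d' l = if l == j then v else d l) ->
  set_mem m (Negz 10 - j%:Z)%R v%:Z%R = layout b i c z e q d' x y.
Proof.
move=> d'E; rewrite digit_cell; apply: functional_extensionality => -[p|p] //.
rewrite /set_mem; case: eqVneq => [[->] | nep].
  by rewrite /= addnC addnK d'E eqxx.
move: p nep => [|[|[|[|[|[|[|[|[|[|p]]]]]]]]]] //= nep.
rewrite d'E; case: eqVneq => // e1; case/eqP: nep; congr Negz; lia.
Qed.

Lemma set_x j (v : bool) x' : j < n ->
  (forall l, l < n -> x' l = if l == j then v else x l) ->
  set_mem m ((n + 2)%:Z + j%:Z)%R (nat_of_bool v)%:Z%R = layout b i c z e q d x' y.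
Proof.
move=> ltj x'E; rewrite -PoszD; apply: functional_extensionality => -[p|p] //.
rewrite /set_mem /layout; case: eqVneq => [[->] | nep].
  rewrite addKn x'E // eqxx ltn_add2l ltj.
  by do 2?[case: ifP => [? | _]; first by exfalso; lia].
case: ifP => // p2; case: ifP => // pn; case: ifP => // pnn.
rewrite x'E; last by lia.
by case: eqVneq => // e1; case/eqP: nep; congr Posz; lia.
Qed.

Lemma set_y j (v : bool) y' : j < n ->
  (forall l, l < n -> y' l = if l == j then v else y l) ->
  set_mem m ((n + 2 + n)%:Z + j%:Z)%R (nat_of_bool v)%:Z%R = layout b i c z e q d x y'.
Proof.
move=> ltj y'E; rewrite -PoszD; apply: functional_extensionality => -[p|p] //.
rewrite /set_mem /layout; case: eqVneq => [[->] | nep].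
  rewrite addKn y'E // eqxx ltn_add2l ltj.
  by do 3?[case: ifP => [? | _]; first by exfalso; lia].
case: ifP => // p2; case: ifP => // pn; case: ifP => // pnn; case: ifP => // pnnn.
rewrite y'E; last by lia.
by case: eqVneq => // e1; case/eqP: nep; congr Posz; lia.
Qed.

End Layout.

(** Zero beyond [D], because [layout] stores every value of the digit function. *)
Definition digit (n D v j : nat) : nat := if j < D then (v %/ n ^ j) %% n else 0.

Section Bound.
Variables (n W k D B : nat) (u : nat -> int).
Hypotheses (n_gt0 : 0 < n) (lekn : k <= n) (leDW : D <= W).
Hypothesis leW : 20 * (n * B.+1) <= W.
Hypothesis uB : forall i, `|u i| <= B.
Local Notation mem := (layout n k D u).

Lemma leW20 : 20 <= W. Proof. by rewrite (leq_trans _ leW) // leq_pmulr // muln_gt0 n_gt0. Qed.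

Lemma len20W : 20 * n <= W.
Proof. by apply: leq_trans leW; rewrite leq_mul2l leq_pmulr. Qed.

Lemma mem_bound b i c z e q d x y : `|b| <= n * B -> i <= W -> c <= n ->
  `|z| <= n * B -> q <= n -> (forall j, d j <= n) ->
  mbound W (mem b i c z e q d x y).
Proof.
move=> hb hi hc hz hq hd; have l1 := len20W; have l2 : n * B <= W.
  by apply: leq_trans leW; rewrite -[n * B]mul1n leq_mul // leq_mul.
case=> [p|p] /=.
  case: ifP => _; first by case: ifP => _; lia.
  case: ifP => _.
    apply: leq_trans (uB _) _; apply: leq_trans l2; exact: leq_pmull.
  case: ifP => _; first by case: (x _); lia.
  by case: ifP => _; first case: (y _); lia.
move: p => [|[|[|[|[|[|[|[|[|[|p]]]]]]]]]] /=; try by lia.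
by apply: leq_trans (hd _) _; lia.
Qed.

End Bound.

(** * Effect of the loop bodies *)

Section Steps.
Variables (S : finType) (f : {set S} -> nat) (n W k D : nat) (u : nat -> int).
Hypothesis leW20 : 20 <= W.
Local Notation mem := (layout n k D u).
Local Notation runs := (runs f W).

Lemma run_init_step b j c z e q d x x' y : mbound W (mem b j c z e q d x y) ->
  j < n -> d 0 < n ->
  (forall l, l < n -> x' l = if l == j then precedes u j (d 0) else x l) ->
  runs init_step (mem b j c z e q d x y) 4 (mem b j c z e q d x' y).
Proof.
move=> mW ltj lt0 x'E.
have wj : eval (mem b j c z e q d x y) (weight_at (rd 3)) = u j.
  exact: mem_weight.
have w0 : eval (mem b j c z e q d x y) (weight_at (rd 10)) = u (d 0).
  exact: mem_weight.
have store (v : bool) s : 0 < s -> precedes u j (d 0) = v ->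
    runs (Store (x_addr (rd 3)) (Lit v)) (mem b j c z e q d x y) s
      (mem b j c z e q d x' y).
  move=> s0 pv; apply: (runs_le s0); apply: (runs_store f leW20) => //.
    by case: (v).
  by apply: set_x => // l ltl; rewrite x'E // pv.
have subE m e1 e2 : eval m (Sub e1 e2) = (eval m e1 - eval m e2)%R by [].
apply: (runs_ite leW20) => //; rewrite subE wj w0 => h1.
  by apply: (store true) => //; rewrite /precedes; lia.
apply: (runs_ite leW20) => //; rewrite subE wj w0 => h2.
  by apply: (store false) => //; rewrite /precedes; lia.
have d0E : eval (mem b j c z e q d x y) (Sub (rd 10) (rd 3)) =
    ((d 0%N)%:Z - j%:Z)%R by [].
apply: (runs_ite leW20) => //; rewrite d0E => h3.
  by apply: (store true) => //; rewrite /precedes; lia.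
by apply: (store false) => //; rewrite /precedes; lia.
Qed.

Lemma run_flip_step b j c z e q d x x' y : mbound W (mem b j c z e q d x y) ->
  d j < n ->
  (forall l, l < n -> x' l = x l (+) (l == d j)) ->
  runs flip_step (mem b j c z e q d x y) 1 (mem b j c z e q d x' y).
Proof.
move=> mW ltd x'E; apply: (runs_store f leW20) => //.
have dE : eval (mem b j c z e q d x y) (x_addr (Read digit_addr)) =
    ((n + 2)%:Z + (d j)%:Z)%R by rewrite -(mem_digit n k D u b j c z e q d x y).
have -> : eval (mem b j c z e q d x y)
    (Sub (Lit 1) (Read (x_addr (Read digit_addr)))) = (~~ x (d j) : nat)%:Z%R.
  rewrite [LHS](_ : _ = 1 - mem b j c z e q d x y ((n + 2)%:Z + (d j)%:Z))%R.
    by rewrite mem_x //; case: (x (d j)).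
  by rewrite -dE.
rewrite dE.
apply: set_x => // l ltl; rewrite x'E //.
by case: eqVneq => [->|_]; rewrite ?addbT ?addbF.
Qed.

Lemma eval_x b j c z e q d x y : j < n ->
  eval (mem b j c z e q d x y) (Read (x_addr (rd 3))) = (x j : nat)%:Z%R.
Proof. exact: mem_x. Qed.

Lemma run_count_step b j c z e q d x y : mbound W (mem b j c z e q d x y) ->
  j < n -> (x j -> mbound W (mem b j c.+1 z e q d x y)) ->
  runs count_step (mem b j c z e q d x y) 3
    (mem b j (c + x j) (if x j then z + u j else z)%R e q d x y).
Proof.
move=> mW ltj mW'; apply: (runs_ite leW20) => //; rewrite eval_x //.
  case xj: (x j) mW' => //= /(_ isT) mW' _.
  apply: (@runs_seq _ _ _ _ _ _ (mem b j c.+1 z e q d x y) _ 1 1).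
    by apply: (runs_store f leW20) => //=; rewrite -PoszD addn1; apply: set_count.
  apply: (runs_store f leW20) => //.
  have wE : eval (mem b j c.+1 z e q d x y) (weight_at (rd 3)) = u j.
    exact: mem_weight.
  by rewrite -wE addn1; apply: set_sum.
case: (x j) => //= _; rewrite addn0; exact: runs_le (runs_skip f W _).
Qed.

Lemma run_save_step b j c z e q d x y y' : mbound W (mem b j c z e q d x y) ->
  j < n -> (forall l, l < n -> y' l = if l == j then x j else y l) ->
  runs save_step (mem b j c z e q d x y) 1 (mem b j c z e q d x y').
Proof.
move=> mW ltj y'E; apply: (runs_store f leW20) => //.
by rewrite eval_x //; apply: set_y.
Qed.

Lemma run_carry_step b j c z (e e' : bool) q d d' x y :
  mbound W (mem b j c z e q d x y) -> d j <= n ->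
  e' = e && (n.-1 <= d j) ->
  (forall l, d' l = if (l == j) && e then (if d j < n.-1 then (d j).+1 else 0) else d l) ->
  mbound W (mem b j c z e q d' x y) ->
  runs carry_step (mem b j c z e q d x y) 4 (mem b j c z e' q d' x y).
Proof.
move=> mW led e'E d'E mW'.
have dE : eval (mem b j c z e q d x y) (Read digit_addr) = (d j)%:Z%R.
  exact: mem_digit.
apply: (runs_ite leW20) => //= e0.
  have {}e0 : e by case: e e0 {mW e'E d'E mW' dE}.
  have eT : e = true by [].
  apply: (runs_ite leW20) => // h.
    have ltd : d j < n.-1 by move: h; rewrite [eval _ _]/= mem_digit; lia.
    apply: (@runs_seq _ _ _ _ _ _ (mem b j c z e q d' x y) _ 1 1).
      apply: (runs_store f leW20) => //.
      rewrite [eval _ (Add _ _)]/= mem_digit -PoszD addn1.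
      by apply: set_digit => l; rewrite d'E eT ltd andbT.
    apply: (runs_store f leW20) => //.
    rewrite (_ : e' = false); first exact: (set_carry _ _ _ _ _ _ _ _ e _ _ _ _ false).
    by rewrite e'E leqNgt ltd andbF.
  have ltd : d j < n.-1 = false.
    by apply/negbTE; move: h; rewrite [eval _ _]/= mem_digit; lia.
  apply: (@runs_le _ _ _ _ _ 1) => //; apply: (runs_store f leW20) => //.
  rewrite e'E leqNgt ltd eT andbT.
  by apply: set_digit => l; rewrite d'E eT ltd andbT.
have eF : e = false by case: e e0 {mW e'E d'E mW' dE}.
rewrite e'E eF /= (_ : d' = d); first by apply: runs_le (runs_skip f W _).
by apply: functional_extensionality => l; rewrite d'E eF andbF.
Qed.

End Steps.

(** * Correctness and running time *)

Lemma dvdn_succ n q : 0 < n -> (n %| q.+1) = (n.-1 <= q %% n).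
Proof.
move=> n0; have ltr := ltn_pmod q n0.
rewrite {1}(divn_eq q n) -addnS dvdn_addr ?dvdn_mull //.
have [ltn | gen] := leqP n (q %% n).+1.
  by rewrite (_ : (q %% n).+1 = n) ?dvdnn; lia.
by rewrite gtnNdvd //; lia.
Qed.

Section Digits.
Variables (n D v p : nat).
Hypotheses (n_gt0 : 0 < n) (ltp : p < D).
Local Notation digit := (digit n D).

Let np_gt0 : 0 < n ^ p. Proof. by rewrite expn_gt0 n_gt0. Qed.

(** A carry reaches position $p$ when all lower digits of $v$ are $n-1$, that is, when $n^p$ divides
    $v+1$. This is the carry in the loop invariant of [run_carry]. *)
Lemma digit_carry :
  (n ^ p.+1 %| v.+1) = (n ^ p %| v.+1) && (n.-1 <= digit v p).
Proof.
rewrite /digit ltp; have [dv | ndv] := boolP (n ^ p %| v.+1); last first.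
  by apply: contraNF ndv; apply: dvdn_trans; rewrite expnS dvdn_mull.
by rewrite expnS -dvdn_divRL // divnS // dv add1n dvdn_succ.
Qed.

Lemma digit_succ : digit v.+1 p =
  if n ^ p %| v.+1 then (if digit v p < n.-1 then (digit v p).+1 else 0)
  else digit v p.
Proof.
rewrite /digit ltp divnS //; case: (n ^ p %| v.+1) => //=.
by rewrite add1n modnS dvdn_succ // leqNgt; case: ltnP.
Qed.

End Digits.

Lemma digit_lt n D v j : 0 < n -> digit n D v j < n.
Proof. by rewrite /digit; case: ifP => // _ n0; apply: ltn_pmod. Qed.

(** Horner's scheme, with [d 0] as least significant digit. *)
Lemma digits_surj n D (d : nat -> nat) : (forall j, d j < n) ->
  exists2 v, v < n ^ D & forall j, j < D -> digit n D v j = d j.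
Proof.
elim: D d => [|D IHD] d ltd; first by exists 0.
have [v ltv vE] := IHD (fun j => d j.+1) (fun j => ltd _).
have n0 : 0 < n by apply: leq_ltn_trans (ltd 0).
exists (v * n + d 0).
  rewrite expnSr; apply: (@leq_trans (v.+1 * n)); last by rewrite leq_mul2r ltv orbT.
  by rewrite mulSn addnC ltn_add2r.
case=> [_|j ltj]; first by rewrite /digit /= divn1 modnMDl modn_small.
rewrite -vE // /digit ltj (ltj : j < D) expnS divnMA.
by rewrite divnMDl // (divn_small (ltd 0)) addn0.
Qed.

Definition size_of (x : nat -> bool) p : nat := \sum_(l < p) x l.
Definition weight_of (u : nat -> int) (x : nat -> bool) p : int :=
  (\sum_(l < p) if x l then u l else 0)%R.

Lemma size_of_le x p : size_of x p <= p.
Proof.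
rewrite -[leqRHS]card_ord -sum1_card leq_sum // => i _; exact: leq_b1.
Qed.

Lemma weight_of_le u B x p : (forall i, `|u i| <= B) -> `|weight_of u x p| <= p * B.
Proof.
move=> uB; elim: p => [|p IHp]; first by rewrite /weight_of big_ord0.
rewrite /weight_of big_ord_recr /= -/(weight_of u x p) mulSn.
by have := uB p; case: (x p); lia.
Qed.

Section LayoutExt.
Variables (n k D : nat) (u : nat -> int).
Local Notation mem := (layout n k D u).

Lemma layout_eqx b i c z e q d x x' y : (forall l, l < n -> x' l = x l) ->
  mem b i c z e q d x y = mem b i c z e q d x' y.
Proof.
move=> xE; apply: functional_extensionality => -[p|p] //=.
case: ifP => // p2; case: ifP => // pn; case: ifP => // pnn.
by rewrite xE //; lia.
Qed.

Lemma layout_eqy b i c z e q d x y y' : (forall l, l < n -> y' l = y l) ->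
  mem b i c z e q d x y = mem b i c z e q d x y'.
Proof.
move=> yE; apply: functional_extensionality => -[p|p] //=.
case: ifP => // p2; case: ifP => // pn; case: ifP => // pnn; case: ifP => // pnnn.
by rewrite yE //; lia.
Qed.

End LayoutExt.

(** * One round of the search, and the output loop *)

Section Round.
Variables (S : finType) (f : {set S} -> nat) (n W k D B : nat) (u : nat -> int).
Hypotheses (cardS : #|S| = n) (n_gt0 : 0 < n) (lekn : k <= n) (leDW : D <= W).
Hypothesis leW : 20 * (n * B.+1) <= W.
Hypothesis uB : forall i, `|u i| <= B.
Hypothesis f_le : forall X, f X <= #|X|.

Local Notation mem := (layout n k D u).
Local Notation runs := (runs f W).
Local Notation weight_of := (weight_of u).

Let W20 : 20 <= W := leW20 n_gt0 leW.

Let lenW : n <= W.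
Proof. by apply: leq_trans (len20W leW); rewrite leq_pmull. Qed.

Section Bounded.
Variables (b z : int) (c q : nat) (d : nat -> nat).
Hypotheses (bB : `|b| <= n * B) (cn : c <= n) (zB : `|z| <= n * B) (qn : q <= n).
Hypothesis dn : forall j, d j < n.

Let bounded b' i c' z' e q' x y : `|b'| <= n * B -> i <= W -> c' <= n ->
  `|z'| <= n * B -> q' <= n -> mbound W (mem b' i c' z' e q' d x y).
Proof. by move=> *; apply: (mem_bound (B := B)) => // j; apply: ltnW. Qed.

Lemma run_init i e x y : i <= W ->
  runs (For (rd 0) init_step) (mem b i c z e q d x y) (n * (4 + 2) + 2)
    (mem b n c z e q d (precedes u ^~ (d 0)) y).
Proof.
move=> iW.
pose G p i := mem b i c z e q d (fun l => if l < p then precedes u l (d 0) else x l) y.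
rewrite [X in runs _ _ _ X](_ : _ = G n n); last first.
  by rewrite /G; apply: layout_eqx => l ->.
apply: (@runs_for _ f W W20 n 4 G) => //= [p j _ jW | p j j' | j ltj].
- exact: bounded.
- exact: set_idx.
- apply: run_init_step => //; first by apply: bounded => //; lia.
  by move=> l _; rewrite ltnS leq_eqVlt; case: eqVneq => [->|].
Qed.

Lemma run_flips i e x y : i <= W ->
  runs (For (rd 1) flip_step) (mem b i c z e q d x y) (D * (1 + 2) + 2)
    (mem b D c z e q d (flips x d D) y).
Proof.
move=> iW; pose G p i := mem b i c z e q d (flips x d p) y.
apply: (@runs_for _ f W W20 D 1 G) => //= [p j _ jW | p j j' | j ltj].
- exact: bounded.
- exact: set_idx.
- apply: run_flip_step => //; apply: bounded => //; lia.
Qed.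

Lemma run_count i e x y : i <= W ->
  runs (For (rd 0) count_step) (mem b i 0 0 e q d x y) (n * (3 + 2) + 2)
    (mem b n (size_of x n) (weight_of x n) e q d x y).
Proof.
move=> iW; pose G p i := mem b i (size_of x p) (weight_of x p) e q d x y.
have -> : mem b i 0 0 e q d x y = G 0 i.
  by rewrite /G /size_of /weight_of !big_ord0.
have leB x' p : p <= n -> `|weight_of x' p| <= n * B.
  by move=> lep; apply: leq_trans (weight_of_le _ _ uB) _; rewrite leq_mul2r lep orbT.
apply: (@runs_for _ f W W20 n 3 G) => //= [p j lep jW | p j j' | j ltj].
- apply: bounded => //; [exact: leq_trans (size_of_le _ _) lep | exact: leB].
- exact: set_idx.
have -> : G j.+1 j = mem b j (size_of x j + x j)
    (if x j then weight_of x j + u j else weight_of x j)%R e q d x y.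
  rewrite /G /size_of /weight_of !big_ord_recr /=.
  by case: (x j); rewrite ?addr0.
have szj := size_of_le x j.
apply: run_count_step => // [|_].
  by apply: bounded; rewrite ?leB //; lia.
by apply: bounded; rewrite ?leB //; lia.
Qed.

Lemma run_save i e x y : i <= W ->
  runs (For (rd 0) save_step) (mem b i c z e q d x y) (n * (1 + 2) + 2)
    (mem b n c z e q d x x).
Proof.
move=> iW.
pose G p i := mem b i c z e q d x (fun l => if l < p then x l else y l).
rewrite [X in runs _ _ _ X](_ : _ = G n n); last first.
  by rewrite /G; apply: layout_eqy => l ->.
apply: (@runs_for _ f W W20 n 1 G) => //= [p j _ jW | p j j' | j ltj].
- exact: bounded.
- exact: set_idx.
- apply: run_save_step => //; first by apply: bounded => //; lia.
  by move=> l _; rewrite ltnS leq_eqVlt; case: eqVneq => [->|].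
Qed.

End Bounded.

Lemma run_carry b i c z q v x y : `|b| <= n * B -> i <= W -> c <= n ->
  `|z| <= n * B -> q <= n ->
  runs (For (rd 1) carry_step) (mem b i c z true q (digit n D v) x y)
    (D * (4 + 2) + 2)
    (mem b D c z (n ^ D %| v.+1) q (digit n D v.+1) x y).
Proof.
move=> bB iW cn zB qn.
(* After [p] iterations the digits below [p] are those of $v+1$; at $p=0$ the carry is set because 1
   divides everything. *)
pose dg p j := if j < p then digit n D v.+1 j else digit n D v j.
pose G p i := mem b i c z (n ^ p %| v.+1) q (dg p) x y.
have -> : mem b i c z true q (digit n D v) x y = G 0 i.
  by rewrite /G expn0 dvd1n.
have -> : mem b D c z (n ^ D %| v.+1) q (digit n D v.+1) x y = G D D.
  rewrite /G (_ : dg D = digit n D v.+1) //.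
  apply: functional_extensionality => j; rewrite /dg; case: ltnP => // leD.
  by rewrite /digit ltnNge leD.
have dgn p j : dg p j < n by rewrite /dg; case: ifP => _; apply: digit_lt.
have bounded p e i' : i' <= W -> mbound W (mem b i' c z e q (dg p) x y).
  by move=> i'W; apply: (mem_bound (B := B)) => // j; apply: ltnW.
apply: (@runs_for _ f W W20 D 4 G) => //= [p j _ jW | p j j' | j ltj].
- exact: bounded.
- exact: set_idx.
have jW : j <= W by lia.
have dgj : dg j j = digit n D v j by rewrite /dg ltnn.
apply: run_carry_step => //; try exact: bounded.
- exact: ltnW.
- by rewrite dgj (@digit_carry n D).
move=> l; rewrite dgj {1}/dg ltnS leq_eqVlt.
case: eqVneq => [->|_] /=; last by [].
by rewrite digit_succ // /dg ltnn.
Qed.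

Lemma query_set b i c z e q d x y :
  set_at S (mem b i c z e q d x y) (Posz (n + 2)) = subset_at S x.
Proof.
apply/setP => s; rewrite !inE mem_x; last by rewrite -cardS.
by case: (x _).
Qed.

Lemma card_subset_at x : #|subset_at S x| = size_of x n.
Proof.
rewrite -sum1_card [LHS](@sum_subset_at S nat (fun=> 1)) big_mkcond /size_of -cardS.
by apply: eq_bigr => i _; case: (x i).
Qed.

Definition candidate v : nat -> bool :=
  flips (precedes u ^~ (digit n D v 0)) (digit n D v) D.

Definition improves x (b : int) : bool :=
  (size_of x n <= f (subset_at S x)) && (b < weight_of x n)%R.

Lemma run_round b i c z q v x y : `|b| <= n * B -> i <= W -> c <= n ->
  `|z| <= n * B -> q <= n ->
  let X := candidate v in
  runs round (mem b i c z false q (digit n D v) x y) (15 * n + 9 * D + 20)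
    (mem (if improves X b then weight_of X n else b) D (size_of X n)
       (weight_of X n) (n ^ D %| v.+1) (f (subset_at S X)) (digit n D v.+1) X
       (if improves X b then X else y)).
Proof.
move=> bB iW cn zB qn X; pose d := digit n D v.
have dn j : d j < n by apply: digit_lt.
have bounded b' i' c' z' e' q' x' y' : `|b'| <= n * B -> i' <= W -> c' <= n ->
    `|z'| <= n * B -> q' <= n -> mbound W (mem b' i' c' z' e' q' d x' y').
  by move=> *; apply: (mem_bound (B := B)) => // j; apply: ltnW.
have szn := size_of_le X n; have wn := weight_of_le X n uB.
have fX : f (subset_at S X) <= n by rewrite -cardS (leq_trans (f_le _)) // max_card.
pose m1 := mem b n c z false q d (precedes u ^~ (d 0)) y.
pose m2 := mem b D c z false q d X y.
pose m3 := mem b D 0 0 false q d X y.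
pose m4 q' := mem b n (size_of X n) (weight_of X n) false q' d X y.
pose b' := if improves X b then weight_of X n else b.
pose y' := if improves X b then X else y.
pose m5 e := mem b' n (size_of X n) (weight_of X n) e (f (subset_at S X)) d X y'.
have r1 : runs (For (rd 0) init_step) (mem b i c z false q d x y) (n * (4 + 2) + 2) m1.
  exact: run_init.
have r2 : runs (For (rd 1) flip_step) m1 (D * (1 + 2) + 2) m2 by apply: run_flips.
have r3 : runs (Seq (Store (cell 4) (Lit 0)) (Store (cell 5) (Lit 0))) m2 (1 + 1) m3.
  apply: (@runs_seq _ _ _ _ _ _ (mem b D 0 z false q d X y)).
    by apply: (runs_store f W20) => //; [exact: bounded | exact: set_count].
  by apply: (runs_store f W20) => //; [exact: bounded | exact: set_sum].
have r4 : runs (For (rd 0) count_step) m3 (n * (3 + 2) + 2) (m4 q).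
  exact: (run_count bB cn zB qn dn).
have r5 : runs (Query (cell 7) (rd 8)) (m4 q) (n + 1) (m4 (f (subset_at S X))).
  rewrite -cardS; apply: (runs_query W20); rewrite ?cardS //.
  - exact: bounded.
  - by have := len20W leW; rewrite /=; lia.
  - by rewrite [eval _ _]/= query_set; lia.
  - by rewrite [eval _ (rd 8)]/= query_set; apply: set_answer.
have r6 : runs (Ite (Sub (Add (rd 7) (Lit 1)) (rd 4))
        (Ite (Sub (rd 5) (rd 2))
          (Seq (Store (cell 2) (rd 5)) (For (rd 0) save_step))
          Skip)
        Skip) (m4 (f (subset_at S X))) (1 + (n * (1 + 2) + 2)).+2 (m5 false).
  apply: (runs_ite W20) => //; first exact: bounded.
    rewrite [eval _ _]/= => h1; apply: (runs_ite W20) => //; first exact: bounded.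
      rewrite [eval _ _]/= => h2; have imp : improves X b by rewrite /improves; lia.
      apply: (@runs_seq _ _ _ _ _ _ (mem (weight_of X n) n (size_of X n)
        (weight_of X n) false (f (subset_at S X)) d X y)).
        by apply: (runs_store f W20) => //; [exact: bounded | exact: set_best].
      by rewrite /m5 /b' /y' imp; apply: run_save.
    rewrite [eval _ _]/= => h2.
    have nimp : improves X b = false by rewrite /improves; lia.
    rewrite /m5 /b' /y' nimp; exact: runs_le (runs_skip f W _).
  rewrite [eval _ _]/= => h1.
  have nimp : improves X b = false by rewrite /improves; lia.
  rewrite /m5 /b' /y' nimp; exact: runs_le (runs_skip f W _).
have b'B : `|b'| <= n * B by rewrite /b'; case: ifP.
have r7 : runs (Store (cell 6) (Lit 1)) (m5 false) 1 (m5 true).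
  apply: (runs_store f W20) => //; first exact: bounded.
  exact: (set_carry _ _ _ _ _ _ _ _ _ _ _ _ _ true).
have r8 : runs (For (rd 1) carry_step) (m5 true) (D * (4 + 2) + 2)
    (mem b' D (size_of X n) (weight_of X n) (n ^ D %| v.+1)
      (f (subset_at S X)) (digit n D v.+1) X y').
  exact: run_carry.
apply: runs_le (runs_seq r1 (runs_seq r2 (runs_seq r3 (runs_seq r4
  (runs_seq r5 (runs_seq r6 (runs_seq r7 r8))))))).
lia.
Qed.

Lemma run_output b i c z e q x y d : `|b| <= n * B -> i <= W -> c <= n ->
  `|z| <= n * B -> q <= n -> (forall j, d j <= n) ->
  exists2 m', runs (For (rd 0) output_step) (mem b i c z e q d x y) (n * (1 + 2) + 2) m'
    & output S m' = subset_at S y.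
Proof.
move=> bB iW cn zB qn dn.
pose G p i' : memory := fun a => if a is Posz l then
  if l < p then Posz (y l) else mem b i' c z e q d x y a
  else mem b i' c z e q d x y a.
have -> : mem b i c z e q d x y = G 0 i.
  by apply: functional_extensionality => -[].
have Gbound p j : j <= W -> mbound W (G p j).
  move=> jW; have mW : mbound W (mem b j c z e q d x y).
    exact: (mem_bound (B := B)).
  case=> l; last exact: mW.
  rewrite /G; case: ifP => _; last exact: mW.
  by case: (y l); have := W20; lia.
exists (G n n).
  apply: (@runs_for _ f W W20 n 1 G) => //= [p j _ jW | p j j' | j ltj].
  - exact: Gbound.
  - apply: functional_extensionality => -[//|l].
    exact: (congr1 (fun m => m (Negz l)) (set_idx n k D u b j c z e q d x y j')).
  apply: (runs_store f W20) => //; first by apply: Gbound; lia.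
  have -> : eval (G j j) (Read (y_addr (rd 3))) = Posz (y j).
    rewrite -(mem_y k D u b j c z e q d x y ltj) -PoszD.
    by rewrite [LHS]/= ifF //; lia.
  rewrite [eval _ (rd 3)]/=.
  apply: functional_extensionality => -[l|l] //; rewrite /G /set_mem.
  case: eqVneq => [[->]|nel]; first by rewrite ltnSn.
  by have -> : (l < j.+1) = (l < j) by lia.
apply/setP => s; rewrite !inE add0r /=.
have -> : enum_rank s < n by rewrite -cardS.
by case: (y _).
Qed.

End Round.

(** * The exhaustive search *)

Section Search.
Variables (S : finType) (f : {set S} -> nat) (n W k D B : nat) (u : nat -> int).
Hypotheses (cardS : #|S| = n) (n_gt0 : 0 < n) (lekn : k <= n) (leDW : D <= W).
Hypothesis leW : 20 * (n * B.+1) <= W.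
Hypothesis uB : forall i, `|u i| <= B.
Hypothesis f_le : forall X, f X <= #|X|.

Local Notation mem := (layout n k D u).
Local Notation runs := (runs f W).
Local Notation candidate := (candidate n D u).
Local Notation weight_of x := (weight_of u x n).

Definition accepted x : bool := size_of x n <= f (subset_at S x).

(** State after the candidates below [v]: the best set is accepted, weighs [b], and beats all of
    them. The bound [0 <= b] accounts for the empty set; the carry flag marks the end. *)
Definition searched (v : nat) (m : memory) : Prop :=
  exists b i c z q x y,
  [/\ m = mem b i c z (v == n ^ D) q (digit n D v) x y,
      [/\ `|b| <= n * B, i <= W, c <= n, `|z| <= n * B & q <= n],
      (0 <= b)%R, accepted y /\ weight_of y = b &
      forall v', v' < v -> accepted (candidate v') -> (weight_of (candidate v') <= b)%R].

Lemma run_search v m : v <= n ^ D -> searched v m ->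
  exists2 m', runs (While (Sub (Lit 1) (rd 6)) round) m
      ((n ^ D - v) * (15 * n + 9 * D + 21) + 1) m'
    & searched (n ^ D) m'.
Proof.
have W20 : 20 <= W := leW20 n_gt0 leW.
have [r] := ubnP (n ^ D - v); elim: r v m => // r IHr v m ltr lev inv.
have [b [i [c [z [q [x [y [mE [bB iW cn zB qn] b0 [ya yw] best]]]]]]]] := inv.
have mW : mbound W m.
  rewrite mE; apply: (mem_bound (B := B)) => // j; exact/ltnW/digit_lt.
move: lev; rewrite leq_eqVlt => /predU1P[vE | ltv].
  exists m; last by rewrite -vE.
  rewrite vE subnn mul0n add0n; apply: (runs_while_false f W20) => //.
  by rewrite mE vE /= eqxx.
have vF : (v == n ^ D) = false by rewrite ltn_eqF.
have := run_round cardS n_gt0 lekn leDW leW uB f_le v x y bB iW cn zB qn.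
rewrite /= -[in X in runs _ X]vF -mE.
set X := candidate v; set b' := if _ then _ else b; set y' := if _ then _ else y.
set m' := layout _ _ _ _ _ _ _ _ _ _ _ _ _ => step.
(* As $0<v+1\le n^D$, divisibility by $n^D$ means equality. *)
have eq_end : (n ^ D %| v.+1) = (v.+1 == n ^ D).
  have [-> | ne] := eqVneq v.+1 (n ^ D); first by rewrite dvdnn.
  by rewrite gtnNdvd // ltn_neqAle ne ltv.
have improvesE : improves f n u X b = accepted X && (b < weight_of X)%R by [].
have [||m2 run2 inv2] := IHr v.+1 m' _ ltv _.
- by lia.
- exists b', D, (size_of X n), (weight_of X), (f (subset_at S X)), X, y'.
  rewrite -eq_end; split=> //.
  + have wX : `|weight_of X| <= n * B by apply: weight_of_le.
    split=> //; [by rewrite /b'; case: ifP | exact: size_of_le |].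
    by rewrite -cardS (leq_trans (f_le _)) // max_card.
  + by rewrite /b'; case: ifP => //; rewrite improvesE => /andP[_ /ltW]; apply: le_trans.
  + rewrite /b' /y'; case: ifP => //; rewrite improvesE => /andP[aX _]; by split.
  move=> v'; rewrite ltnS leq_eqVlt => /predU1P[-> | ltv'].
    rewrite -/X /b' => aX; rewrite improvesE aX /=; case: ltP => //.
  move=> /(best _ ltv')/le_trans; apply; rewrite /b'; case: ifP => //.
  by rewrite improvesE => /andP[_ /ltW].
exists m2 => //.
have -> : (n ^ D - v) * (15 * n + 9 * D + 21) + 1 =
    (15 * n + 9 * D + 20 + ((n ^ D - v.+1) * (15 * n + 9 * D + 21) + 1)).+1.
  by rewrite -(subnSK ltv) mulSn; lia.
apply: (runs_while_true W20 mW) step run2 => //.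
by rewrite mE vF.
Qed.

End Search.

(** * Initial memory, time bound and conclusion *)

Lemma weight_subset_at (S : finType) (w : S -> int) x :
  (\sum_(s in subset_at S x) w s)%R = weight_of (weights w) x #|S|.
Proof.
rewrite /weight_of -big_mkcond -(sum_subset_at S (weights w)).
by apply: eq_bigr => s _; rewrite weights_rank.
Qed.

Lemma weights_le (S : finType) (w : S -> int) B i :
  (forall s, `|w s| <= B) -> `|weights w i| <= B.
Proof.
move=> wB; have [lti | gei] := ltnP i #|S|; last first.
  by rewrite /weights nth_default // size_map -cardE.
by have := weights_rank w (enum_val (Ordinal lti)); rewrite enum_valK => ->.
Qed.

Lemma run_setup (S : finType) (f : {set S} -> nat) W k B (w : S -> int) :
  k <= #|S| -> 20 * (#|S| * B.+1) <= W -> 0 < #|S| -> (forall s, `|w s| <= B) ->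
  runs f W setup (input k w) 4
    (layout #|S| k (4 * k).+1 (weights w) 0 0 0 0 false 0 (digit #|S| (4 * k).+1 0)
       xpred0 xpred0).
Proof.
set n := #|S| => lekn leW n0 wB; have W20 : 20 <= W := leW20 n0 leW.
have lenW := len20W leW; have leB : B <= W.
  apply: leq_trans leW; apply: leq_trans (leqnSn _) _.
  by rewrite mulnA leq_pmull // muln_gt0.
have inB : mbound W (input k w).
  move=> [[|[|i]]|i] //=; rewrite -/n; try lia.
  exact: leq_trans (weights_le i wB) leB.
pose m1 := set_mem (input k w) (Negz 0) n%:Z%R.
have b1 : mbound W m1 by apply: mbound_set => //; lia.
pose m2 := set_mem m1 (Negz 1) (4 * k).+1%:Z%R.
have b2 : mbound W m2 by apply: mbound_set => //; lia.
pose m3 := set_mem m2 (Negz 8) (n + 2)%:Z%R.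
have b3 : mbound W m3 by apply: mbound_set => //; lia.
apply: (@runs_seq _ _ _ _ _ _ m1 _ 1 3); first exact: (runs_store f W20).
apply: (@runs_seq _ _ _ _ _ _ m2 _ 1 2).
  apply: (runs_store f W20) => //; rewrite /m2; congr set_mem.
  by rewrite [LHS]/= /m1 /set_mem /=; lia.
apply: (@runs_seq _ _ _ _ _ _ m3 _ 1 1); first exact: (runs_store f W20).
apply: (runs_store f W20) => //.
rewrite [eval _ _]/= [eval _ (Add _ _)]/=.
apply: functional_extensionality => -[p|p].
  case: p => [|[|p]] //; rewrite /layout [LHS](_ : _ = weights w p) // !subSS subn0.
  case: ifP => // gep.
  have -> : weights w p = 0%R by rewrite /weights nth_default // size_map -cardE -/n; lia.
  by case: ifP => // _; case: ifP.
move: p => [|[|[|[|[|[|[|[|[|[|p]]]]]]]]]] //.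
rewrite /m3 /m2 /m1 /set_mem /= /digit; case: ifP => // _.
by rewrite div0n mod0n.
Qed.

(** Logarithms of the factors add up; the crude estimate $n\le 2^n$ is enough, since $n\le n^k$ is
    allowed in the time bound. *)
Lemma trunc_log_bound n B c : 0 < n -> 0 < c ->
  (trunc_log 2 (c * (n * B.+1))) <= trunc_log 2 c + n + trunc_log 2 B + 2.
Proof.
move=> n0 c0.
have nB0 : 0 < c * (n * B.+1) by rewrite !muln_gt0 c0 n0.
rewrite -ltnS -(@ltn_exp2l 2) //; apply: leq_ltn_trans (trunc_logP _ nB0) _ => //.
have lc := trunc_log_ltn c (isT : 1 < 2).
have ln := ltn_expl n (isT : 1 < 2).
have lB := trunc_log_ltn B (isT : 1 < 2).
have -> : (trunc_log 2 c + n + trunc_log 2 B + 2).+1 =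
    (trunc_log 2 c).+1 + (n + ((trunc_log 2 B).+1 + 1)) by lia.
rewrite !(expnD _ (trunc_log 2 c).+1) (expnD _ n).
apply: (@leq_ltn_trans (c * (2 ^ n * 2 ^ ((trunc_log 2 B).+1 + 1)))).
  rewrite leq_mul2l leq_mul ?orbT //; first exact: ltnW.
  by apply: leq_trans lB _; rewrite leq_exp2l // leq_addr.
by rewrite ltn_pmul2r // muln_gt0 !expn_gt0.
Qed.

(** The outer variable stands for $\log B$, the inner one for $N=|S|^k$. The factor is
    $3800=95\cdot40$: at most $95N^6$ steps, each worth 40 words. *)
Definition time_bound : {poly {poly nat}} :=
  let c : {poly nat} := (polyC 3800 * 'X^6)%R in
  ((c * ('X + polyC 11%N))%:P + c%:P * 'X)%R.

Lemma time_boundE L N :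
  (time_bound.[L%:P].[N])%R = 3800 * N ^ 6 * (N + 11 + L).
Proof.
rewrite !(hornerD, hornerM, hornerC, hornerX, hornerXn) -mulrDr.
by rewrite !expnS expn0 muln1.
Qed.

(** Since $n\le N$, there are $n\cdot N^4\le N^5$ rounds; since $k\le n$, each costs at most $81N$
    steps. The slack up to 95 absorbs setup and output. *)
Lemma steps_le n k : 0 < k <= n ->
  4 + (n ^ (4 * k).+1 * (15 * n + 9 * (4 * k).+1 + 21) + 1 + (n * (1 + 2) + 2))
    <= 95 * (n ^ k) ^ 6.
Proof.
case/andP=> k0 lekn; have n0 : 0 < n by apply: leq_trans k0 lekn.
set N := n ^ k; have lenN : n <= N by rewrite -[n in n <= _]expn1 leq_pexp2l.
have N0 : 0 < N by apply: leq_trans n0 lenN.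
have pN j : 0 < N ^ j by rewrite expn_gt0 N0.
have h1 : n ^ (4 * k).+1 <= N ^ 5.
  by rewrite expnS (expnS N 4) -expnM (mulnC k 4) leq_mul2r lenN orbT.
have h2 : 15 * n + 9 * (4 * k).+1 + 21 <= 81 * N by lia.
have h3 : N <= N ^ 6 by rewrite -[leqLHS]expn1 leq_pexp2l.
have h4 := leq_mul h1 h2; have -> : 95 * N ^ 6 = 95 * (N ^ 5 * N) by rewrite expnSr.
rewrite expnSr in h3; lia.
Qed.

Theorem theorem4p4 :
  exists (prog : cmd) (p : {poly {poly nat}}),
  forall (S : finType) (M1 M2 : matroid S) (r k B : nat) (w : S -> int),
    rank M1 [set: S] = r -> rank M2 [set: S] = r ->
    0 < k <= r ->
    (forall X : {set S}, #|X| <= r - k -> rank M1 X = #|X| /\ rank M2 X = #|X|) ->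
    (forall X : {set S}, r + k <= #|X| -> rank M1 X = r /\ rank M2 X = r) ->
    (forall s, `|w s|%N <= B) ->
  exists (t : nat) (m : memory),
    [/\ exec (rmin M1 M2) prog (input k w) t m,
        t <= (p.[(trunc_log 2 B)%:P].[(#|S| ^ k)%N])%R
      & max_weight_common_indep M1 M2 w (output S m)].
Proof.
exists program, time_bound => S M1 M2 r k B w rM1 rM2 /andP[k0 lekr] small _ wB.
pose n := #|S|; pose D := (4 * k).+1; pose W := 20 * (n * B.+1).
pose f := rmin M1 M2; pose u := weights w.
have lern : r <= n by rewrite /n -rM1 -cardsT rank_le_card.
have lekn : k <= n by apply: leq_trans lekr lern.
have n0 : 0 < n by apply: leq_trans k0 lekn.
have leDW : D <= W by apply: leq_trans (len20W (leqnn W)); rewrite /D; lia.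
have uB i : `|u i| <= B by apply: weights_le.
have fle X : f X <= #|X| by apply: rmin_le_card.
have cardS : #|S| = n by [].
have r1 := run_setup f lekn (leqnn W) n0 wB.
set m1 := layout _ _ _ _ _ _ _ _ _ _ _ _ _ in r1.
have start : searched f n W k D B u 0 m1.
  exists 0%R, 0, 0, 0%R, 0, xpred0, xpred0; split=> //.
    by rewrite (ltn_eqF (_ : 0 < n ^ D)) // expn_gt0 n0.
  by rewrite /accepted /size_of /weight_of !big1.
have [m2 r2 final] := run_search cardS n0 lekn leDW (leqnn W) uB fle (leq0n _) start.
have [b [i [c [z [q [x [y [mE [bB iW cn zB qn] b0 [ya yw] best]]]]]]]] := final.
rewrite mE in r2.
have [|m3 r3 outE] := @run_output S f n W k D B u cardS n0 lekn leDW (leqnn W)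
  uB b i c z (n ^ D == n ^ D) q x y (digit n D (n ^ D)) bB iW cn zB qn.
  by move=> j; apply/ltnW/digit_lt.
have [t ex let_] := runs_seq r1 (runs_seq r2 r3).
exists t, m3; split=> //.
  rewrite time_boundE; apply: leq_trans let_ _.
  rewrite subn0.
  have -> : 3800 = 95 * 40 by [].
  have hs := @steps_le n k; rewrite k0 lekn in hs; have {}hs := hs isT.
  have hl := @trunc_log_bound n B 320 n0 isT.
  have hn : n <= n ^ k by rewrite -[n in n <= _]expn1 leq_pexp2l.
  have hw : wordbits W <= n ^ k + 11 + trunc_log 2 B.
    rewrite /wordbits /W mulnA (_ : 16 * 20 = 320) //.
    have l320 : trunc_log 2 320 = 8 by []; rewrite l320 in hl; lia.
  apply: leq_trans (leq_mul hs (leq_mul (leqnn 40) hw)) _.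
  by rewrite mulnACA mulnA.
rewrite outE; have yc : subset_at S y \in common_indep M1 M2.
  by rewrite common_indep_rmin (card_subset_at cardS).
have [I [Ic maxI] Icand] := optimal_candidate w rM1 rM2 lekr small.
split=> // J Jc; apply: le_trans (maxI J Jc) _.
rewrite weight_subset_at -/n -/u yw.
(* An empty optimum has weight 0, which is at most [b]; any other is the candidate of some counter
   value [v]. *)
case: Icand => [-> | [d dlt IE]]; first by rewrite big_set0.
have [v ltv vE] := digits_surj D dlt.
have {}IE : I = subset_at S (candidate n D u v).
  rewrite IE; apply/setP => s; rewrite !inE /candidate !flipsE vE //; congr (_ (+) odd (count _ _)).
  by apply/eq_in_map => j; rewrite mem_iota => /vE.
have := best v ltv; rewrite IE weight_subset_at; apply.
by rewrite /accepted -(card_subset_at cardS) -/f -common_indep_rmin -IE.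
Qed.
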